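(* The norm $|||\cdot|||$ on $c_0$ given by \[ |||x|||=\|x\|_\infty+\left(\sum_{n=1}^\infty 2^{-n}|x(n)|^2\right)^{1/2}\quad\text{for } x=(x(n))_{n=1}^\infty\in c_0 \] is weakly locally uniformly rotund.
   Context: Here $c_0$ is the space of scalar sequences $x=(x(n))_{n=1}^\infty$ converging to $0$, and $\|x\|_\infty=\sup_n|x(n)|$ is the standard supremum norm. A norm $\|\cdot\|$ on a Banach space is called weakly locally uniformly rotund if for arbitrary points $x_n$ ($n=1,2,\ldots$) and $x$ of its unit sphere, $\lim_{n\to\infty}\|x_n+x\|=2$ implies that $(x_n)_{n=1}^\infty$ converges weakly to $x$. *)

(* Defs.v *)
From Stdlib Require Import Reals Lra FunctionalExtensionality ProofIrrelevance.
From Coquelicot Require Import Coquelicot.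
Open Scope R_scope.

(* Sequences are indexed from 0: x(n) of the 1-indexed convention is [x (n-1)].
   The scalars form an [AbsRing], to be instantiated with R and with C. *)

Record c0 (K : AbsRing) : Type := mk_c0 {
  c0_seq :> nat -> K;
  c0_lim : filterlim c0_seq eventually (locally (zero : K)) }.

Arguments mk_c0 {K} _ _.
Arguments c0_seq {K} _ _.
Arguments c0_lim {K} _.

Definition norm_inf {K : AbsRing} (u : nat -> K) : R :=
  real (Sup_seq (fun n => Finite (abs (u n)))).

Section C0_space.

Context {K : AbsRing}.

Lemma c0_eq (x y : c0 K) : (forall n, x n = y n) -> x = y.
Proof.
destruct x as [u Hu], y as [v Hv]; simpl; intros H.
assert (E : u = v) by (apply functional_extensionality; exact H).
subst v; f_equal; apply proof_irrelevance.
Qed.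

Lemma c0_plus_lim (x y : c0 K) :
  filterlim (fun n => plus (x n) (y n)) eventually (locally (zero : K)).
Proof.
rewrite <- (plus_zero_l (zero : K)).
apply (filterlim_comp_2 _ _ plus (c0_lim x) (c0_lim y)).
exact (@filterlim_plus K (AbsRing_NormedModule K) zero zero).
Qed.

Lemma c0_opp_lim (x : c0 K) :
  filterlim (fun n => opp (x n)) eventually (locally (zero : K)).
Proof.
replace (zero : K) with (opp (zero : K)) by exact (opp_zero (G := K)).
apply (filterlim_comp _ _ _ _ _ _ _ _ (c0_lim x)).
exact (@filterlim_opp K (AbsRing_NormedModule K) zero).
Qed.

Lemma c0_scal_lim (a : K) (x : c0 K) :
  filterlim (fun n => mult a (x n)) eventually (locally (zero : K)).
Proof.
replace (zero : K) with (mult a (zero : K)) by exact (mult_zero_r a).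
apply (filterlim_comp _ _ _ _ _ _ _ _ (c0_lim x)).
exact (@filterlim_scal_r K (AbsRing_NormedModule K) a zero).
Qed.

Lemma c0_zero_lim : filterlim (fun _ : nat => zero : K) eventually (locally (zero : K)).
Proof. apply filterlim_const. Qed.

Definition c0_plus (x y : c0 K) : c0 K := mk_c0 _ (c0_plus_lim x y).
Definition c0_opp (x : c0 K) : c0 K := mk_c0 _ (c0_opp_lim x).
Definition c0_scal (a : K) (x : c0 K) : c0 K := mk_c0 _ (c0_scal_lim a x).
Definition c0_zero : c0 K := mk_c0 _ c0_zero_lim.

Lemma c0_plus_comm x y : c0_plus x y = c0_plus y x.
Proof. apply c0_eq; intros n; apply plus_comm. Qed.

Lemma c0_plus_assoc x y z : c0_plus x (c0_plus y z) = c0_plus (c0_plus x y) z.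
Proof. apply c0_eq; intros n; apply plus_assoc. Qed.

Lemma c0_plus_zero_r x : c0_plus x c0_zero = x.
Proof. apply c0_eq; intros n; apply plus_zero_r. Qed.

Lemma c0_plus_opp_r x : c0_plus x (c0_opp x) = c0_zero.
Proof. apply c0_eq; intros n; exact (plus_opp_r (x n)). Qed.

Definition c0_AbelianMonoid_mixin :=
  AbelianMonoid.Mixin (c0 K) c0_plus c0_zero
    c0_plus_comm c0_plus_assoc c0_plus_zero_r.

Canonical c0_AbelianMonoid :=
  AbelianMonoid.Pack (c0 K) c0_AbelianMonoid_mixin (c0 K).

Definition c0_AbelianGroup_mixin :=
  AbelianGroup.Mixin c0_AbelianMonoid c0_opp c0_plus_opp_r.

Canonical c0_AbelianGroup :=
  AbelianGroup.Pack (c0 K) (AbelianGroup.Class _ _ c0_AbelianGroup_mixin) (c0 K).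

Lemma c0_scal_assoc (a b : K) (x : c0 K) :
  c0_scal a (c0_scal b x) = c0_scal (mult a b) x.
Proof. apply c0_eq; intros n; exact (mult_assoc a b (x n)). Qed.

Lemma c0_scal_one (x : c0 K) : c0_scal one x = x.
Proof. apply c0_eq; intros n; exact (mult_one_l (x n)). Qed.

Lemma c0_scal_distr_l (a : K) (x y : c0 K) :
  c0_scal a (plus x y) = plus (c0_scal a x) (c0_scal a y).
Proof. apply c0_eq; intros n; exact (mult_distr_l a (x n) (y n)). Qed.

Lemma c0_scal_distr_r (a b : K) (x : c0 K) :
  c0_scal (plus a b) x = plus (c0_scal a x) (c0_scal b x).
Proof. apply c0_eq; intros n; exact (mult_distr_r a b (x n)). Qed.

Definition c0_ModuleSpace_mixin :=
  ModuleSpace.Mixin K c0_AbelianGroup c0_scal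
    c0_scal_assoc c0_scal_one c0_scal_distr_l c0_scal_distr_r.

Canonical c0_ModuleSpace :=
  ModuleSpace.Pack K (c0 K) (ModuleSpace.Class K _ _ c0_ModuleSpace_mixin) (c0 K).

Lemma c0_bounded (x : c0 K) : exists M, forall n, abs (x n) <= M.
Proof.
destruct (@filterlim_bounded K (AbsRing_NormedModule K) x) as [M HM].
- exists zero; exact (c0_lim x).
- exists M; exact HM.
Qed.

Lemma norm_inf_lub (u : nat -> K) (M : R) :
  (forall n, abs (u n) <= M) ->
  (forall n, abs (u n) <= norm_inf u) /\ norm_inf u <= M.
Proof.
intros HM; unfold norm_inf.
generalize (Sup_seq_correct (fun n => Finite (abs (u n)))).
destruct (Sup_seq _) as [l| |]; simpl; intros H.
- split.
  + intros n; apply le_epsilon; intros e He.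
    apply Rlt_le, (proj1 (H (mkposreal e He)) n).
  + apply le_epsilon; intros e He.
    destruct (proj2 (H (mkposreal e He))) as [n Hn]; simpl in Hn.
    specialize (HM n); lra.
- destruct (H M) as [n Hn]; specialize (HM n); lra.
- specialize (H 0 O); generalize (abs_ge_0 (u O)); lra.
Qed.

Lemma norm_inf_ge (x : c0 K) n : abs (x n) <= norm_inf x.
Proof. destruct (c0_bounded x) as [M HM]; apply (norm_inf_lub x M HM). Qed.

Lemma norm_inf_le (x : c0 K) M : (forall n, abs (x n) <= M) -> norm_inf x <= M.
Proof. intros HM; apply (norm_inf_lub x M HM). Qed.

Lemma norm_inf_plus (x y : c0 K) :
  norm_inf (plus x y) <= norm_inf x + norm_inf y.
Proof.
apply (norm_inf_le (plus x y)); intros n.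
apply Rle_trans with (1 := abs_triangle (x n) (y n)).
apply Rplus_le_compat; apply norm_inf_ge.
Qed.

Lemma norm_inf_scal (a : K) (x : c0 K) :
  norm_inf (scal a x) <= abs a * norm_inf x.
Proof.
apply (norm_inf_le (scal a x)); intros n.
apply Rle_trans with (1 := abs_mult a (x n)).
apply Rmult_le_compat_l; [apply abs_ge_0 | apply norm_inf_ge].
Qed.

Lemma norm_inf_eq0 (x : c0 K) : norm_inf x = 0 -> x = zero.
Proof.
intros H; apply c0_eq; intros n; apply abs_eq_zero.
apply Rle_antisym; [rewrite <- H; apply norm_inf_ge | apply abs_ge_0].
Qed.

Lemma norm_inf_zero : norm_inf (zero : c0 K) = 0.
Proof.
apply Rle_antisym.
- apply (norm_inf_le zero); intros n; apply Req_le, abs_zero.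
- apply Rle_trans with (2 := norm_inf_ge zero O); apply abs_ge_0.
Qed.

Lemma norm_inf_opp (x : c0 K) : norm_inf (opp x) = norm_inf x.
Proof.
unfold norm_inf; f_equal; apply Sup_seq_ext; intros n.
f_equal; apply (abs_opp (x n)).
Qed.

Definition c0_ball (x : c0 K) (e : R) (y : c0 K) : Prop :=
  norm_inf (minus y x) < e.

Lemma c0_ball_center (x : c0 K) (e : posreal) : c0_ball x e x.
Proof.
unfold c0_ball.
assert (E : minus x x = zero :> c0 K) by exact (minus_eq_zero x).
rewrite E, norm_inf_zero; apply cond_pos.
Qed.

Lemma c0_ball_sym (x y : c0 K) (e : R) : c0_ball x e y -> c0_ball y e x.
Proof. unfold c0_ball; rewrite <- (opp_minus y x), norm_inf_opp; trivial. Qed.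

Lemma c0_ball_triangle (x y z : c0 K) (e1 e2 : R) :
  c0_ball x e1 y -> c0_ball y e2 z -> c0_ball x (e1 + e2) z.
Proof.
unfold c0_ball; intros H1 H2.
rewrite (minus_trans y z x).
apply Rle_lt_trans with (1 := norm_inf_plus (minus z y) (minus y x)); lra.
Qed.

Definition c0_UniformSpace_mixin :=
  UniformSpace.Mixin (c0 K) zero c0_ball
    c0_ball_center c0_ball_sym c0_ball_triangle.

Canonical c0_UniformSpace :=
  UniformSpace.Pack (c0 K) c0_UniformSpace_mixin (c0 K).

Canonical c0_NormedModuleAux :=
  NormedModuleAux.Pack K (c0 K)
    (NormedModuleAux.Class K (c0 K) (ModuleSpace.class _ c0_ModuleSpace)
       c0_UniformSpace_mixin) (c0 K).

Lemma c0_norm_compat1 (x y : c0 K) (e : R) :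
  norm_inf (minus y x) < e -> ball x e y.
Proof. trivial. Qed.

Lemma c0_norm_compat2 (x y : c0 K) (e : posreal) :
  ball x e y -> norm_inf (minus y x) < 1 * e.
Proof. rewrite Rmult_1_l; trivial. Qed.

Definition c0_NormedModule_mixin :=
  NormedModule.Mixin K c0_NormedModuleAux (fun x : c0 K => norm_inf x) 1
    norm_inf_plus norm_inf_scal c0_norm_compat1 c0_norm_compat2 norm_inf_eq0.

Canonical c0_NormedModule :=
  NormedModule.Pack K (c0 K)
    (NormedModule.Class K (c0 K) _ c0_NormedModule_mixin) (c0 K).

End C0_space.

Section Rotundity.

Context {K : AbsRing} {X : NormedModule K}.

Definition is_norm (N : X -> R) : Prop :=
  (forall x, 0 <= N x) /\
  (forall x, N x = 0 -> x = zero) /\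
  (forall (a : K) x, N (scal a x) = abs a * N x) /\
  (forall x y, N (plus x y) <= N x + N y).

(* [is_linear] includes boundedness, so [f] ranges over the dual of [X]
   for its own norm. *)
Definition converges_weakly (u : nat -> X) (x : X) : Prop :=
  forall f : X -> K, is_linear f ->
    filterlim (fun n => f (u n)) eventually (locally (f x)).

(* [N] need not be the norm carried by [X]: a second norm on the same space. *)
Definition weakly_locally_uniformly_rotund (N : X -> R) : Prop :=
  is_norm N /\
  forall (u : nat -> X) (x : X),
    (forall n, N (u n) = 1) -> N x = 1 ->
    is_lim_seq (fun n => N (plus (u n) x)) 2 ->
    converges_weakly u x.

End Rotundity.

Definition triple_norm (K : AbsRing) (x : c0 K) : R :=
  norm_inf x + sqrt (Series (fun n => / 2 ^ S n * abs (x n) ^ 2)).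

(* Main.v *)
Require Import Defs.
From Stdlib Require Import Reals Lra Lia.
From Coquelicot Require Import Coquelicot.

(* Write |x| for the weighted l2-norm, so that |||x||| = ||x|| + |x|. If
   |||u_n||| = |||x||| = 1 and |||u_n + x||| -> 2, then the triangle inequality is
   asymptotically an equality for both summands. With t_n = |u_n| / |x|, the identity
     |u - t x|^2 = (1 + t) |u|^2 + t (1 + t) |x|^2 - t |u + x|^2
   gives u_n - t_n x -> 0 coordinatewise. Comparing a coordinate where |x(k)| is nearly
   ||x|| with ||u_n|| = 1 - t_n |x| gives limsup t_n <= 1. As x tends to 0, ||u_n + x||
   is nearly attained on a fixed finite set of coordinates, where u_n is close to t_n x;
   hence ||u_n|| + ||x|| <= (1 + t_n) ||x|| + o(1), which gives liminf t_n >= 1.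
   So u_n -> x coordinatewise, and u_n is bounded, hence u_n -> x weakly because a
   bounded functional on c_0 has absolutely summable coefficients. *)

(* What the argument needs to know about the scalar field, so that it runs once for
   R and C. *)
Record real_scalars (K : AbsRing) := {
  iota : R -> K;
  iota_one : iota 1 = one;
  iota_plus : forall s t, iota (s + t) = plus (iota s) (iota t);
  abs_iota : forall t, abs (iota t) = Rabs t;
  abs_mult_eq : forall a b : K, abs (mult a b) = abs a * abs b;
  abs_minus_sq : forall (t : R) (a b : K),
    abs (minus a (mult (iota t) b)) ^ 2 =
    (1 + t) * abs a ^ 2 + t * (1 + t) * abs b ^ 2 - t * abs (plus a b) ^ 2;
  phase : forall a : K, exists s, abs s <= 1 /\ mult s a = iota (abs a) }.

Arguments iota {K} _ _.

(** * Real and complex scalars *)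

Lemma abs_minus_sym {K : AbsRing} (a b : K) : abs (minus a b) = abs (minus b a).
Proof. rewrite <- (opp_minus b a); exact (abs_opp (minus b a)). Qed.

Lemma R_real_scalars : real_scalars R_AbsRing.
Proof.
apply (Build_real_scalars R_AbsRing (fun t => t)); try reflexivity.
- exact Rabs_mult.
- intros t a b.
  change (Rabs (a + - (t * b)) ^ 2 =
    (1 + t) * Rabs a ^ 2 + t * (1 + t) * Rabs b ^ 2 - t * Rabs (a + b) ^ 2).
  rewrite <- !Rsqr_pow2, <- !Rsqr_abs; unfold Rsqr; ring.
- intros a; change (exists s, Rabs s <= 1 /\ s * a = Rabs a).
  destruct (Rle_lt_dec 0 a).
  + exists 1; rewrite Rabs_R1, Rabs_pos_eq; lra.
  + exists (-1); rewrite Rabs_m1, Rabs_left; lra.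
Qed.

Lemma Cmod_sq (z : C) : Cmod z ^ 2 = fst z ^ 2 + snd z ^ 2.
Proof. apply pow2_sqrt; generalize (pow2_ge_0 (fst z)) (pow2_ge_0 (snd z)); lra. Qed.

Lemma C_real_scalars : real_scalars C_AbsRing.
Proof.
apply (Build_real_scalars C_AbsRing RtoC).
- reflexivity.
- exact RtoC_plus.
- exact Cmod_R.
- exact Cmod_mult.
- intros t a b.
  change (Cmod (a - RtoC t * b)%C ^ 2 =
    (1 + t) * Cmod a ^ 2 + t * (1 + t) * Cmod b ^ 2 - t * Cmod (a + b)%C ^ 2).
  rewrite !Cmod_sq; destruct a, b; simpl; ring.
- intros a; change (exists s : C, Cmod s <= 1 /\ Cmult s a = RtoC (Cmod a)).
  destruct (Ceq_dec a 0) as [->|Ha].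
  + exists 0%C; rewrite Cmod_0; split; [lra|ring].
  + assert (P := proj1 (Cmod_gt_0 a) Ha).
    assert (P' : RtoC (Cmod a) <> 0%C) by (intros E; apply RtoC_inj in E; lra).
    exists (Cconj a / RtoC (Cmod a))%C; split.
    * rewrite Cmod_div, Cmod_conj, Cmod_R, Rabs_pos_eq by (trivial; lra).
      apply Req_le; field; lra.
    * replace (Cconj a / RtoC (Cmod a) * a)%C with (a * Cconj a / RtoC (Cmod a))%C
        by (field; trivial).
      assert (E : (a * Cconj a)%C = RtoC (Cmod a ^ 2)).
      { rewrite Cmod_sq; destruct a; unfold Cconj, Cmult, RtoC; simpl; f_equal; ring. }
      rewrite E; simpl; rewrite Rmult_1_r, RtoC_mult; field; trivial.
Qed.

Lemma plus_minus_cancel {G : AbelianGroup} (a b : G) : plus b (minus a b) = a.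
Proof.
unfold minus; rewrite plus_comm, <- plus_assoc.
transitivity (plus a (zero : G)); [f_equal; exact (plus_opp_l b)|apply plus_zero_r].
Qed.

(** * Bounded functionals on c_0 and coordinatewise convergence *)

Section WeakConvergence.

Context {K : AbsRing} (E : real_scalars K).

Lemma c0_trunc_lim (n : nat) (g : nat -> K) :
  filterlim (fun k => if Nat.ltb k n then g k else zero)
    eventually (locally (zero : K)).
Proof.
apply filterlim_ext_loc with (fun _ => zero).
- exists n; intros k Hk; rewrite (proj2 (Nat.ltb_ge k n) Hk); reflexivity.
- apply filterlim_const.
Qed.

(** [g] is an arbitrary sequence, so that sequences of phases, which need not tend to 0, can be
    truncated too. *)
Definition c0_trunc (n : nat) (g : nat -> K) : c0 K := mk_c0 _ (c0_trunc_lim n g).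

Definition c0_unit (k : nat) : c0 K :=
  c0_trunc (S k) (fun i => if Nat.eqb i k then one else zero).

Lemma c0_trunc_S (n : nat) (g : nat -> K) :
  c0_trunc (S n) g = plus (c0_trunc n g) (scal (g n) (c0_unit n)).
Proof.
apply c0_eq; intros k.
change ((if Nat.ltb k (S n) then g k else zero) =
  plus (if Nat.ltb k n then g k else zero)
    (mult (g n) (if Nat.ltb k (S n) then if Nat.eqb k n then one else zero else zero))).
destruct (Nat.ltb_spec k (S n)), (Nat.ltb_spec k n), (Nat.eqb_spec k n); try lia;
  subst; rewrite ?mult_zero_r, ?mult_one_r, ?plus_zero_l, ?plus_zero_r; reflexivity.
Qed.

(** Partial sums of the l1-norm of the sequence that represents [f] in the duality between c_0 and
    l1. *)
Fixpoint coef_sum (f : c0 K -> K) (n : nat) : R :=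
  match n with
  | O => 0
  | S m => coef_sum f m + abs (f (c0_unit m))
  end.

Lemma coef_sum_le_S (f : c0 K -> K) n : coef_sum f n <= coef_sum f (S n).
Proof. simpl; generalize (abs_ge_0 (f (c0_unit n))); lra. Qed.

Lemma norm_c0 (x : c0 K) : norm x = norm_inf x.
Proof. reflexivity. Qed.

Context (f : c0 K -> K) (Hf : is_linear f).

Lemma linear_c0_trunc_S n g :
  f (c0_trunc (S n) g) = plus (f (c0_trunc n g)) (mult (g n) (f (c0_unit n))).
Proof. rewrite c0_trunc_S, (linear_plus f Hf), (linear_scal f Hf); reflexivity. Qed.

Lemma linear_c0_trunc_0 g : f (c0_trunc 0 g) = zero.
Proof.
transitivity (f zero); [f_equal; apply c0_eq; reflexivity|exact (linear_zero f Hf)].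
Qed.

Lemma iota_zero : iota E 0 = zero.
Proof. apply abs_eq_zero; rewrite (abs_iota K E); exact Rabs_R0. Qed.

(* Testing [f] on the finitely supported vectors built from the phases of its
   coefficients bounds their l1-norm. *)
Lemma coef_sum_bounded : exists M, forall n, coef_sum f n <= M.
Proof.
destruct (linear_norm f Hf) as [M [HM0 HM]].
exists M; intros n.
assert (exists s : nat -> K, (forall k, abs (s k) <= 1) /\
  f (c0_trunc n s) = iota E (coef_sum f n)) as [s [Hs Es]].
{ induction n as [|n [s [Hs Es]]].
  - exists (fun _ => zero); split; [intros k; rewrite abs_zero; lra|].
    rewrite linear_c0_trunc_0; symmetry; exact iota_zero.
  - destruct (phase K E (f (c0_unit n))) as [p [Hp Ep]].
    (* Overwriting coordinate [n] by the new phase leaves the truncation at [n] unchanged. *)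
    exists (fun k => if Nat.eqb k n then p else s k); split.
    + intros k; destruct (Nat.eqb k n); trivial.
    + rewrite linear_c0_trunc_S, Nat.eqb_refl; simpl (coef_sum _ _).
      rewrite (iota_plus K E), <- Ep, <- Es; do 2 f_equal.
      apply c0_eq; intros k; simpl.
      destruct (Nat.ltb_spec k n); trivial.
      destruct (Nat.eqb_spec k n); trivial; lia. }
apply Rle_trans with (1 := Rle_abs _).
rewrite <- (abs_iota K E), <- Es.
apply Rle_trans with (1 := HM _).
rewrite norm_c0; rewrite <- (Rmult_1_r M) at 2.
apply Rmult_le_compat_l; [lra|].
apply norm_inf_le; intros k; simpl.
destruct (Nat.ltb k n); trivial; rewrite abs_zero; lra.
Qed.

(** Each coordinate from [N] on contributes at most [d] times the modulus of the matching
    coefficient of [f]. *)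
Lemma linear_c0_trunc_le (w : nat -> K) (d : R) (N j : nat) :
  (forall k, (N <= k < N + j)%nat -> abs (w k) <= d) ->
  abs (f (c0_trunc (N + j) w)) <=
    abs (f (c0_trunc N w)) + d * (coef_sum f (N + j) - coef_sum f N).
Proof.
induction j as [|j IH]; intros Hd.
- rewrite Nat.add_0_r; lra.
- rewrite Nat.add_succ_r, linear_c0_trunc_S; simpl.
  apply Rle_trans with (1 := abs_triangle _ _).
  rewrite (abs_mult_eq K E).
  assert (A := IH (fun k Hk => Hd k ltac:(lia))).
  assert (B := Rmult_le_compat_r _ _ _ (abs_ge_0 (f (c0_unit (N + j))))
    (Hd (N + j)%nat ltac:(lia))).
  lra.
Qed.

Lemma c0_eventually_small (x : c0 K) (e : R) :
  0 < e -> exists N, forall k, (N <= k)%nat -> abs (x k) < e.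
Proof.
intros He.
destruct (proj1 (filterlim_locally _ _) (c0_lim x) (mkposreal e He)) as [N HN].
exists N; intros k Hk; specialize (HN k Hk).
replace (x k) with (minus (x k) zero); [exact HN|].
unfold minus; rewrite opp_zero, plus_zero_r; reflexivity.
Qed.

(** Truncations of an element of c_0 converge to it in the sup norm, so by continuity of [f] the
    bound passes to the limit. *)
Lemma linear_c0_le_trunc (w : c0 K) (b : R) (N : nat) :
  (forall j, abs (f (c0_trunc (N + j) w)) <= b) -> abs (f w) <= b.
Proof.
destruct (linear_norm f Hf) as [M [HM0 HM]].
intros Hb; apply le_epsilon; intros e He.
destruct (c0_eventually_small w (e / M)) as [j Hj]; [apply Rdiv_lt_0_compat; lra|].
set (v := c0_trunc (N + j) w).
assert (Hv : norm_inf (minus w v) <= e / M).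
{ apply (norm_inf_le (minus w v)); intros k.
  change (abs (minus (w k) (if Nat.ltb k (N + j) then w k else zero)) <= e / M).
  destruct (Nat.ltb_spec k (N + j)).
  - rewrite (minus_eq_zero (w k) : _ = (zero : K)), abs_zero; apply Rlt_le, Rdiv_lt_0_compat; lra.
  - unfold minus; rewrite opp_zero, plus_zero_r; apply Rlt_le, Hj; lia. }
assert (Ew : w = plus v (minus w v)) by (symmetry; exact (plus_minus_cancel w v)).
rewrite Ew, (linear_plus f Hf).
apply Rle_trans with (1 := abs_triangle _ _).
apply Rplus_le_compat; [apply Hb|].
apply Rle_trans with (1 := HM _).
rewrite norm_c0; apply Rle_trans with (M * (e / M)); [apply Rmult_le_compat_l; lra|].
apply Req_le; field; lra.
Qed.

(** The l1 coefficients are split at [N]: the head contributes at most [d] times their total sum,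
    the tail at most |B| times a small remainder. *)
Lemma linear_c0_small (B e : R) : 0 < e ->
  exists N d, 0 < d /\ forall w : c0 K,
    (forall k, abs (w k) <= B) -> (forall k, (k < N)%nat -> abs (w k) <= d) ->
    abs (f w) < e.
Proof.
intros He.
destruct coef_sum_bounded as [M HM].
destruct (ex_finite_lim_seq_incr (coef_sum f) M (coef_sum_le_S f) HM) as [L HL].
assert (HLle := is_lim_seq_incr_compare _ _ HL (coef_sum_le_S f)).
(* Adding 1 to |B| here, and to [L] below, keeps the divisors positive when these numbers vanish.
   Head and tail then each stay within e/3. *)
assert (Hr : 0 < e / 3 / (Rabs B + 1)).
{ generalize (Rabs_pos B); intros; apply Rdiv_lt_0_compat; lra. }
destruct (proj2 (is_lim_seq_spec _ _) HL (mkposreal _ Hr)) as [N HN].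
specialize (HN N (le_n N)); simpl in HN; apply Rabs_def2 in HN.
assert (HL0 : 0 <= L) by exact (HLle O).
exists N, (e / 3 / (L + 1)); split; [apply Rdiv_lt_0_compat; lra|].
intros w HB Hd.
apply Rle_lt_trans with (e / 3 / (L + 1) * L + Rabs B * (e / 3 / (Rabs B + 1))).
- apply linear_c0_le_trunc with N; intros j.
  apply Rle_trans with (1 := linear_c0_trunc_le w (Rabs B) N j
    (fun k _ => Rle_trans _ _ _ (HB k) (Rle_abs B))).
  apply Rplus_le_compat.
  + generalize (linear_c0_trunc_le w (e / 3 / (L + 1)) 0 N (fun k Hk => Hd k (proj2 Hk))).
    rewrite linear_c0_trunc_0, abs_zero; simpl; intros H.
    apply Rle_trans with (1 := H); rewrite Rplus_0_l, Rminus_0_r.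
    apply Rmult_le_compat_l; [apply Rlt_le, Rdiv_lt_0_compat; lra|apply HLle].
  + apply Rmult_le_compat_l; [apply Rabs_pos|].
    specialize (HLle (N + j)%nat); lra.
- assert (A : e / 3 / (L + 1) * L <= e / 3).
  { apply Rle_trans with (e / 3 / (L + 1) * (L + 1)).
    - apply Rmult_le_compat_l; [apply Rlt_le, Rdiv_lt_0_compat; lra|lra].
    - apply Req_le; field; lra. }
  generalize (Rabs_pos B); intros B0.
  assert (A' : Rabs B * (e / 3 / (Rabs B + 1)) <= e / 3).
  { apply Rle_trans with ((Rabs B + 1) * (e / 3 / (Rabs B + 1))).
    - apply Rmult_le_compat_r; lra.
    - apply Req_le; field; lra. }
  lra.
Qed.

Lemma eventually_below (P : nat -> nat -> Prop) (N : nat) :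
  (forall k, eventually (P k)) -> eventually (fun n => forall k, (k < N)%nat -> P k n).
Proof.
intros HP; induction N as [|N IH].
- exists O; intros; lia.
- generalize (filter_and _ _ IH (HP N)); apply filter_imp; intros n [H1 H2] k Hk.
  destruct (Nat.eq_dec k N); [subst; trivial|apply H1; lia].
Qed.

Lemma linear_c0_pointwise (u : nat -> c0 K) (x : c0 K) (B : R) :
  (forall n k, abs (minus (u n k) (x k)) <= B) ->
  (forall k e, 0 < e -> eventually (fun n => abs (minus (u n k) (x k)) < e)) ->
  filterlim (fun n => f (u n)) eventually (locally (f x)).
Proof.
intros HB Hu; apply filterlim_locally; intros [e He]; simpl.
destruct (linear_c0_small B e He) as [N [d [Hd HN]]].
generalize (eventually_below _ N (fun k => Hu k d Hd)); apply filter_imp; intros n Hn.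
change (abs (minus (f (u n)) (f x)) < e).
replace (minus (f (u n)) (f x)) with (f (minus (u n) x)).
- apply HN; [exact (HB n)|intros k Hk; apply Rlt_le, (Hn k Hk)].
- unfold minus; rewrite (linear_plus f Hf), (linear_opp f _ Hf); reflexivity.
Qed.

End WeakConvergence.

(** * The weighted l2-norm and the norm axioms *)

Section TripleNorm.

Context {K : AbsRing} (E : real_scalars K).

Definition wsq (x : c0 K) : R := Series (fun n => / 2 ^ S n * abs (x n) ^ 2).

Lemma wsq_term_ge0 (x : c0 K) n : 0 <= / 2 ^ S n * abs (x n) ^ 2.
Proof.
apply Rmult_le_pos; [apply Rlt_le, Rinv_0_lt_compat, pow_lt; lra|apply pow2_ge_0].
Qed.

(** Domination by a geometric series, since the coordinates are bounded by the sup norm. *)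
Lemma ex_series_wsq (x : c0 K) : ex_series (fun n => / 2 ^ S n * abs (x n) ^ 2).
Proof.
apply (@ex_series_le R_AbsRing R_CompleteNormedModule) with (fun n => norm_inf x ^ 2 * (/ 2) ^ n).
- intros n; change (Rabs (/ 2 ^ S n * abs (x n) ^ 2) <= norm_inf x ^ 2 * (/ 2) ^ n).
  rewrite Rabs_pos_eq by apply wsq_term_ge0.
  rewrite Rmult_comm; apply Rmult_le_compat.
  + apply pow2_ge_0.
  + apply Rlt_le, Rinv_0_lt_compat, pow_lt; lra.
  + apply pow_incr; split; [apply abs_ge_0|apply norm_inf_ge].
  + rewrite <- pow_inv; simpl; generalize (pow_lt (/ 2) n); lra.
- apply (ex_series_scal (V := R_NormedModule)), ex_series_geom; rewrite Rabs_pos_eq; lra.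
Qed.

Lemma wsq_ge_term (x : c0 K) k : / 2 ^ S k * abs (x k) ^ 2 <= wsq x.
Proof.
unfold wsq; rewrite (Series_incr_n _ (S k)) by (lia || apply ex_series_wsq).
apply Rle_trans with (sum_f_R0 (fun n => / 2 ^ S n * abs (x n) ^ 2) k).
- destruct k as [|k]; [simpl; lra|].
  rewrite tech5; generalize (cond_pos_sum _ k (wsq_term_ge0 x)); lra.
- rewrite Nat.pred_succ, <- (Rplus_0_r (sum_f_R0 _ _)) at 1; apply Rplus_le_compat_l.
  rewrite <- (Rmult_0_l (Series (fun _ => 0))), <- Series_scal_l.
  apply Series_le.
  + intros n; rewrite Rmult_0_l; split; [lra|apply wsq_term_ge0].
  + exact (proj1 (@ex_series_incr_n R_AbsRing R_NormedModule _ (S k)) (ex_series_wsq x)).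
Qed.

Lemma wsq_ge0 (x : c0 K) : 0 <= wsq x.
Proof. apply Rle_trans with (2 := wsq_ge_term x O), wsq_term_ge0. Qed.

Lemma wsq_eq0 (x : c0 K) : wsq x = 0 -> x = zero.
Proof.
intros H; apply c0_eq; intros k; apply abs_eq_zero.
assert (P : 0 < / 2 ^ S k) by (apply Rinv_0_lt_compat, pow_lt; lra).
assert (Z : abs (x k) ^ 2 <= 0).
{ apply Rmult_le_reg_l with (1 := P); rewrite Rmult_0_r, <- H; apply wsq_ge_term. }
generalize (abs_ge_0 (x k)); nra.
Qed.

Lemma wsq_scal (a : K) (x : c0 K) : wsq (scal a x) = abs a ^ 2 * wsq x.
Proof.
unfold wsq; rewrite <- Series_scal_l; apply Series_ext; intros n.
change (scal a x n) with (mult a (x n)); rewrite (abs_mult_eq K E); ring.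
Qed.

(** The scalar identity [abs_minus_sq] summed over the coordinates; it stands in for expanding an
    inner product. *)
Lemma wsq_minus (t : R) (u v : c0 K) :
  wsq (minus u (scal (iota E t) v)) =
  (1 + t) * wsq u + t * (1 + t) * wsq v - t * wsq (plus u v).
Proof.
unfold wsq; rewrite <- !Series_scal_l.
assert (S := fun c x => @ex_series_scal R_AbsRing R_NormedModule c _ (ex_series_wsq x)).
rewrite <- Series_plus by apply S.
rewrite <- Series_minus by (apply S || apply (ex_series_plus (V := R_NormedModule)); apply S).
apply Series_ext; intros n.
change (minus u (scal (iota E t) v) n) with (minus (u n) (mult (iota E t) (v n))).
rewrite (abs_minus_sq K E).
change (plus u v n) with (plus (u n) (v n)); ring.
Qed.

Definition wnorm (x : c0 K) : R := sqrt (wsq x).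

Lemma wnorm_ge0 x : 0 <= wnorm x.
Proof. apply sqrt_pos. Qed.

Lemma wnorm_sq x : wnorm x ^ 2 = wsq x.
Proof. apply pow2_sqrt, wsq_ge0. Qed.

Lemma wnorm_eq0 (x : c0 K) : wnorm x = 0 -> x = zero.
Proof. intros H; apply wsq_eq0; rewrite <- wnorm_sq, H; ring. Qed.

Lemma triple_norm_eq x : triple_norm K x = norm_inf x + wnorm x.
Proof. reflexivity. Qed.

(* [u - (|u| / |v|) v] measures the defect in the triangle inequality for the
   weighted l2-norm. *)
Lemma wsq_defect (u v : c0 K) : 0 < wnorm v ->
  wsq (minus u (scal (iota E (wnorm u / wnorm v)) v)) =
  wnorm u / wnorm v * ((wnorm u + wnorm v) ^ 2 - wnorm (plus u v) ^ 2).
Proof.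
intros Hv; rewrite wsq_minus, <- !wnorm_sq; field; lra.
Qed.

(** The defect is nonnegative, being a value of [wsq], and its factor |u| / |v| is positive once the
    cases of zero norm are set aside; so |u + v|^2 <= (|u| + |v|)^2. *)
Lemma wnorm_plus (u v : c0 K) : wnorm (plus u v) <= wnorm u + wnorm v.
Proof.
destruct (wnorm_ge0 v) as [Hv|Hv].
2: { rewrite <- Hv, (wnorm_eq0 v), plus_zero_r by easy; lra. }
destruct (wnorm_ge0 u) as [Hu|Hu].
2: { rewrite <- Hu, (wnorm_eq0 u), plus_zero_l by easy; lra. }
assert (Ht : 0 < wnorm u / wnorm v) by (apply Rdiv_lt_0_compat; trivial).
generalize (wsq_ge0 (minus u (scal (iota E (wnorm u / wnorm v)) v))).
rewrite wsq_defect by trivial; intros H.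
apply Rsqr_incr_0_var; [unfold Rsqr; nra|lra].
Qed.

Lemma norm_inf_ge0 (x : c0 K) : 0 <= norm_inf x.
Proof. apply Rle_trans with (2 := norm_inf_ge x O), abs_ge_0. Qed.

Lemma norm_inf_scal_eq (a : K) (x : c0 K) :
  norm_inf (scal a x) = abs a * norm_inf x.
Proof.
apply Rle_antisym; [apply norm_inf_scal|].
destruct (abs_ge_0 a) as [Ha|Ha].
- apply Rmult_le_reg_l with (/ abs a); [apply Rinv_0_lt_compat; trivial|].
  rewrite <- Rmult_assoc, Rinv_l, Rmult_1_l by lra.
  apply norm_inf_le; intros n.
  apply Rmult_le_reg_l with (abs a); trivial.
  rewrite <- Rmult_assoc, Rinv_r, Rmult_1_l by lra.
  rewrite <- (abs_mult_eq K E); exact (norm_inf_ge (scal a x) n).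
- rewrite <- Ha, Rmult_0_l; apply norm_inf_ge0.
Qed.

Lemma wnorm_scal (a : K) (x : c0 K) : wnorm (scal a x) = abs a * wnorm x.
Proof.
unfold wnorm; rewrite wsq_scal, sqrt_mult by (apply pow2_ge_0 || apply wsq_ge0).
rewrite sqrt_pow2 by apply abs_ge_0; reflexivity.
Qed.

Lemma triple_norm_is_norm : is_norm (triple_norm K).
Proof.
split; [|split; [|split]]; [intros x|intros x H|intros a x|intros x y]; rewrite ?triple_norm_eq.
- generalize (norm_inf_ge0 x) (wnorm_ge0 x); lra.
- rewrite triple_norm_eq in H; apply norm_inf_eq0; generalize (norm_inf_ge0 x) (wnorm_ge0 x); lra.
- rewrite norm_inf_scal_eq, wnorm_scal; ring.
- apply Rle_trans with ((norm_inf x + norm_inf y) + (wnorm x + wnorm y)); [|lra].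
  apply Rplus_le_compat; [apply norm_inf_plus|apply wnorm_plus].
Qed.

(** * Unit vectors [u] for which |||u + x||| is close to 2 *)

Context (x : c0 K) (Hx : triple_norm K x = 1).

(** If either summand vanished, [x] would be zero and so would the other, contrary to their sum
    being 1. *)
Lemma unit_pos : 0 < norm_inf x /\ 0 < wnorm x.
Proof.
rewrite triple_norm_eq in Hx; split.
- destruct (norm_inf_ge0 x) as [H|H]; trivial.
  assert (Z := norm_inf_eq0 x (eq_sym H)).
  assert (wnorm x = 0); [|lra].
  replace x with (scal (zero : K) x) by (rewrite Z; exact (scal_zero_r zero)).
  rewrite wnorm_scal, abs_zero; ring.
- destruct (wnorm_ge0 x) as [H|H]; trivial.
  assert (Z := wnorm_eq0 x (eq_sym H)).
  rewrite Z, norm_inf_zero in Hx; rewrite <- Z in Hx; lra.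
Qed.

(** The factor t of the overview: t x has the same weighted l2-norm as [u]. *)
Let ratio (u : c0 K) : R := wnorm u / wnorm x.

Lemma ratio_bounds u : triple_norm K u = 1 -> 0 <= ratio u <= / wnorm x.
Proof.
destruct unit_pos as [Hs Ha]; rewrite triple_norm_eq; intros Hu; unfold ratio, Rdiv.
assert (0 < / wnorm x) by (apply Rinv_0_lt_compat; trivial).
generalize (norm_inf_ge0 u) (wnorm_ge0 u); nra.
Qed.

(** The triangle defects of the two summands are nonnegative and add up to less than [d], so the l2
    defect is below [d]. This makes u - t x small in the weighted l2-norm, hence small on the first
    coordinates. *)
Lemma near_ray (k0 : nat) (e : R) : 0 < e ->
  exists d, 0 < d /\ forall u, triple_norm K u = 1 ->
    2 - d < triple_norm K (plus u x) ->
    forall k, (k <= k0)%nat -> abs (minus (u k) (mult (iota E (ratio u)) (x k))) < e.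
Proof.
intros He; destruct unit_pos as [Hs Ha].
assert (P := pow_lt 2 (S k0) ltac:(lra)).
(* The factor [wnorm x] offsets the bound 1/|x| on t, 4 bounds |u| + |x| + |u + x|, and 1/2^(k0+1)
   is the least weight among coordinates up to [k0]. *)
exists (wnorm x * e ^ 2 / (4 * 2 ^ S k0)); split.
{ apply Rdiv_lt_0_compat; [apply Rmult_lt_0_compat; [lra|apply pow_lt; trivial]|lra]. }
set (d := wnorm x * e ^ 2 / (4 * 2 ^ S k0)).
intros u Hu Hd k Hk.
assert (Q : wsq (minus u (scal (iota E (ratio u)) x)) < e ^ 2 / 2 ^ S k0).
{ destruct (ratio_bounds u Hu) as [T0 T1].
  unfold ratio; rewrite wsq_defect by trivial; fold (ratio u).
  rewrite !triple_norm_eq in *.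
  assert (A := norm_inf_plus u x); assert (B := wnorm_plus u x).
  assert (I0 := norm_inf_ge0 u); assert (I1 := wnorm_ge0 (plus u x)); assert (I2 := wnorm_ge0 u).
  assert (D : (wnorm u + wnorm x) ^ 2 - wnorm (plus u x) ^ 2 < 4 * d).
  { assert (D1 : 0 <= wnorm u + wnorm x - wnorm (plus u x) < d) by lra.
    assert (D2 : wnorm u + wnorm x + wnorm (plus u x) <= 4) by lra.
    replace ((wnorm u + wnorm x) ^ 2 - wnorm (plus u x) ^ 2) with
      ((wnorm u + wnorm x - wnorm (plus u x)) * (wnorm u + wnorm x + wnorm (plus u x))) by ring.
    apply Rle_lt_trans with ((wnorm u + wnorm x - wnorm (plus u x)) * 4); [|lra].
    apply Rmult_le_compat_l; lra. }
  assert (D0 : 0 <= (wnorm u + wnorm x) ^ 2 - wnorm (plus u x) ^ 2) by nra.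
  apply Rle_lt_trans with (/ wnorm x * ((wnorm u + wnorm x) ^ 2 - wnorm (plus u x) ^ 2)).
  - apply Rmult_le_compat_r; trivial.
  - apply Rlt_le_trans with (/ wnorm x * (4 * d)).
    + apply Rmult_lt_compat_l; [apply Rinv_0_lt_compat; trivial|trivial].
    + unfold d; apply Req_le; field; split; lra. }
assert (W := wsq_ge_term (minus u (scal (iota E (ratio u)) x)) k).
change (minus u (scal (iota E (ratio u)) x) k)
  with (minus (u k) (mult (iota E (ratio u)) (x k))) in W.
set (z := abs (minus (u k) (mult (iota E (ratio u)) (x k)))) in *.
assert (P' : / 2 ^ S k0 <= / 2 ^ S k).
{ apply Rinv_le_contravar; [apply pow_lt; lra|apply Rle_pow; [lra|lia]]. }
assert (Z : / 2 ^ S k0 * z ^ 2 < / 2 ^ S k0 * e ^ 2).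
{ apply Rle_lt_trans with (wsq (minus u (scal (iota E (ratio u)) x))).
  - apply Rle_trans with (2 := W), Rmult_le_compat_r; [apply pow2_ge_0|trivial].
  - rewrite Rmult_comm; exact Q. }
apply Rmult_lt_reg_l in Z; [|apply Rinv_0_lt_compat; trivial].
assert (0 <= z) by apply abs_ge_0; nra.
Qed.

Lemma abs_ratio_mult u k : triple_norm K u = 1 ->
  abs (mult (iota E (ratio u)) (x k)) = ratio u * abs (x k).
Proof.
intros Hu; rewrite (abs_mult_eq K E), (abs_iota K E), Rabs_pos_eq; trivial.
apply ratio_bounds; trivial.
Qed.

(** At a coordinate where |x(k)| > ||x|| - r, one gets t (||x|| - r) <= ||u|| + r = 1 - t |x| + r,
    that is t <= 1 + r + t r. *)
Lemma ratio_lt (e : R) : 0 < e ->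
  exists d, 0 < d /\ forall u, triple_norm K u = 1 ->
    2 - d < triple_norm K (plus u x) -> ratio u < 1 + e.
Proof.
intros He; destruct unit_pos as [Hs Ha].
assert (Hi : 0 < / wnorm x) by (apply Rinv_0_lt_compat; trivial).
(* Chosen so that r + t r <= e, given t <= 1/|x|. *)
set (r := e / (1 + / wnorm x)).
assert (Hr : 0 < r) by (apply Rdiv_lt_0_compat; lra).
assert (Er : r * (1 + / wnorm x) = e) by (unfold r; field; split; lra).
assert (exists k, norm_inf x - r < abs (x k)) as [k Hk].
(* Otherwise ||x|| - r would be an upper bound of the coordinates smaller than their supremum. *)
{ destruct (Classical_Prop.classic (exists k, norm_inf x - r < abs (x k))) as [H|H]; trivial.
  assert (norm_inf x <= norm_inf x - r); [|lra].
  apply norm_inf_le; intros k; apply Rnot_lt_le; intros Hk; apply H; exists k; trivial. }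
destruct (near_ray k r Hr) as [d [Hd Hray]].
exists d; split; trivial; intros u Hu Hn.
specialize (Hray u Hu Hn k (le_n k)).
destruct (ratio_bounds u Hu) as [T0 T1].
assert (A : ratio u * abs (x k) <= abs (u k) + r).
{ rewrite <- abs_ratio_mult by trivial.
  rewrite <- (plus_minus_cancel (mult (iota E (ratio u)) (x k)) (u k)).
  apply Rle_trans with (1 := abs_triangle _ _); apply Rplus_le_compat_l.
  apply Rle_trans with (1 := Req_le _ _ (abs_minus_sym _ _)); apply Rlt_le, Hray. }
assert (B := norm_inf_ge u k).
assert (C : wnorm u = ratio u * wnorm x) by (unfold ratio; field; lra).
rewrite triple_norm_eq in Hu, Hx; nra.
Qed.

(** Up to [N] the coordinates of [u] are close to those of t x; beyond [N] those of [x] are below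
    ||x||/2, too small for ||u + x|| to be nearly ||u|| + ||x||. *)
Lemma ratio_gt (e : R) : 0 < e ->
  exists d, 0 < d /\ forall u, triple_norm K u = 1 ->
    2 - d < triple_norm K (plus u x) -> 1 - e < ratio u.
Proof.
intros He; destruct unit_pos as [Hs Ha].
destruct (c0_eventually_small x (norm_inf x / 2)) as [N HN]; [lra|].
destruct (near_ray N (e / 2)) as [d [Hd Hray]]; [lra|].
exists (Rmin d (Rmin (norm_inf x / 2) (e / 2))); split.
{ repeat apply Rmin_glb_lt; lra. }
intros u Hu Hn.
assert (M1 := Rmin_l d (Rmin (norm_inf x / 2) (e / 2))).
assert (M2 := Rmin_r d (Rmin (norm_inf x / 2) (e / 2))).
assert (M3 := Rmin_l (norm_inf x / 2) (e / 2)).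
assert (M4 := Rmin_r (norm_inf x / 2) (e / 2)).
specialize (Hray u Hu ltac:(lra)).
destruct (ratio_bounds u Hu) as [T0 T1].
assert (C : wnorm u = ratio u * wnorm x) by (unfold ratio; field; lra).
assert (A : norm_inf (plus u x) <=
  Rmax ((1 + ratio u) * norm_inf x + e / 2) (norm_inf u + norm_inf x / 2)).
{ apply norm_inf_le; intros k; change (plus u x k) with (plus (u k) (x k)).
  apply Rle_trans with (1 := abs_triangle _ _).
  assert (Xk := norm_inf_ge x k).
  destruct (Nat.le_gt_cases k N) as [Hk|Hk].
  - apply Rle_trans with (2 := Rmax_l _ _).
    assert (abs (u k) <= ratio u * abs (x k) + e / 2); [|nra].
    rewrite <- abs_ratio_mult by trivial.
    rewrite <- (plus_minus_cancel (u k) (mult (iota E (ratio u)) (x k))) at 1.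
    apply Rle_trans with (1 := abs_triangle _ _); apply Rplus_le_compat_l, Rlt_le, Hray, Hk.
  - apply Rle_trans with (2 := Rmax_r _ _).
    apply Rplus_le_compat; [apply norm_inf_ge|apply Rlt_le, HN; lia]. }
assert (B := wnorm_plus u x).
rewrite !triple_norm_eq in *.
(* The first bound gives 2 - e/2 < 1 + t + e/2. The second would give |||u + x||| <= 2 - ||x||/2,
   which the choice of the threshold excludes. *)
revert A; apply Rmax_case; intros A; nra.
Qed.

Lemma minus_mult_plus_one (b c : K) : minus (mult (plus b one) c) c = mult b c.
Proof.
unfold minus.
transitivity (plus (plus (mult b c) c) (opp c)).
- f_equal; transitivity (plus (mult b c) (mult one c)); [exact (mult_distr_r b one c)|].
  f_equal; exact (mult_one_l c).
- rewrite <- plus_assoc.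
  transitivity (plus (mult b c) zero); [f_equal; exact (plus_opp_r c)|exact (plus_zero_r _)].
Qed.

Lemma abs_minus_ratio u k :
  abs (minus (mult (iota E (ratio u)) (x k)) (x k)) = Rabs (ratio u - 1) * abs (x k).
Proof.
rewrite <- (abs_iota K E), <- (abs_mult_eq K E), <- (minus_mult_plus_one (iota E (ratio u - 1))).
rewrite <- (iota_one K E), <- (iota_plus K E).
replace (ratio u - 1 + 1) with (ratio u) by ring; reflexivity.
Qed.

(** In u - x = (u - t x) + (t - 1) x each part is below e/2 at coordinate [k], up to equality in the
    second, since |x(k)| <= 1. *)
Lemma near_pointwise (k : nat) (e : R) : 0 < e ->
  exists d, 0 < d /\ forall u, triple_norm K u = 1 ->
    2 - d < triple_norm K (plus u x) -> abs (minus (u k) (x k)) < e.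
Proof.
intros He; destruct unit_pos as [Hs Ha].
destruct (near_ray k (e / 2)) as [d1 [Hd1 H1]]; [lra|].
destruct (ratio_lt (e / 2)) as [d2 [Hd2 H2]]; [lra|].
destruct (ratio_gt (e / 2)) as [d3 [Hd3 H3]]; [lra|].
exists (Rmin d1 (Rmin d2 d3)); split.
{ repeat apply Rmin_glb_lt; trivial. }
intros u Hu Hn.
assert (M1 := Rmin_l d1 (Rmin d2 d3)); assert (M2 := Rmin_r d1 (Rmin d2 d3)).
assert (M3 := Rmin_l d2 d3); assert (M4 := Rmin_r d2 d3).
specialize (H1 u Hu ltac:(lra) k (le_n k)).
specialize (H2 u Hu ltac:(lra)); specialize (H3 u Hu ltac:(lra)).
rewrite (minus_trans (mult (iota E (ratio u)) (x k))).
apply Rle_lt_trans with (1 := abs_triangle _ _).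
rewrite abs_minus_ratio.
assert (R1 : Rabs (ratio u - 1) < e / 2) by (apply Rabs_def1; lra).
assert (X1 : abs (x k) <= 1).
{ apply Rle_trans with (1 := norm_inf_ge x k); rewrite triple_norm_eq in Hx; lra. }
replace e with (e / 2 + e / 2) by lra; apply Rplus_lt_le_compat; [exact H1|].
generalize (abs_ge_0 (x k)) (Rabs_pos (ratio u - 1)); nra.
Qed.

End TripleNorm.

(** * Weak local uniform rotundity *)

Lemma triple_norm_wlur {K : AbsRing} (E : real_scalars K) :
  weakly_locally_uniformly_rotund (triple_norm K).
Proof.
split; [exact (triple_norm_is_norm E)|].
intros u x Hu Hx Hlim f Hf.
apply (linear_c0_pointwise E f Hf u x 2).
- intros n k.
  (* Unit vectors have coordinates of modulus at most 1, whence the uniform bound 2 on the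
     differences. *)
  assert (A : forall y : c0 K, triple_norm K y = 1 -> abs (y k) <= 1).
  { intros y Hy; rewrite triple_norm_eq in Hy.
    generalize (norm_inf_ge y k) (wnorm_ge0 y); lra. }
  apply Rle_trans with (1 := abs_triangle _ _).
  refine (Rle_trans _ _ _ (Rplus_le_compat_l _ _ _ (Req_le _ _ (abs_opp _))) _).
  generalize (A _ (Hu n)) (A _ Hx); lra.
- intros k e He.
  destruct (near_pointwise E x Hx k e He) as [d [Hd H]].
  generalize (proj2 (is_lim_seq_spec _ _) Hlim (mkposreal d Hd)); simpl.
  apply filter_imp; intros n Hn; apply H; [apply Hu|].
  apply Rabs_def2, proj2 in Hn.
  apply Rplus_lt_reg_r with (- 2); replace (2 - d + - 2) with (- d) by ring; exact Hn.
Qed.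

Theorem proposition4 :
  weakly_locally_uniformly_rotund (triple_norm R_AbsRing) /\
  weakly_locally_uniformly_rotund (triple_norm C_AbsRing).
Proof.
split; apply triple_norm_wlur; [exact R_real_scalars|exact C_real_scalars].
Qed.
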